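(* Let $X$ be a Hausdorff space and $\kappa$ an infinite cardinal. (a) $X$ is H-closed if and only if $X$ is $\aleph_0$wH-closed. (b) $X$ is $\kappa$wH-closed if and only if for each $\kappa$-wide open filter base $\mathcal F$ on $X$, $a\mathcal F\neq\varnothing$.
   Context: A Hausdorff space $X$ is H-closed if every open cover $\mathcal V$ of $X$ has a finite subfamily $\mathcal W$ with $X=\bigcup_{W\in\mathcal W}cl\,W$. For $A\subseteq X$, $cl_\theta(A)=\{x\in X: cl(U)\cap A\neq\varnothing\text{ for every open }U\ni x\}$. For a filter base $\mathcal F$ on $X$, $a\mathcal F=\bigcap\{cl(F):F\in\mathcal F\}$ and $a_\theta\mathcal F=\bigcap\{cl_\theta(F):F\in\mathcal F\}$. An open filter base is a filter base consisting of open sets. A filter base $\mathcal F$ on $X$ is $\kappa$-wide if $|cl_\theta(A)|\geq\kappa$ for each $A\in\mathcal F$. $X$ is $\kappa$wH-closed if $a_\theta\mathcal F\neq\varnothing$ for each $\kappa$-wide filter base $\mathcal F$ on $X$. *)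

(* Defs.v *)
From mathcomp Require Import all_boot all_order.
From mathcomp Require Import boolp classical_sets functions cardinality topology.
Set Implicit Arguments.
Unset Strict Implicit.
Unset Printing Implicit Defensive.
Local Open Scope classical_set_scope.
Local Open Scope card_scope.

(* A cardinal is represented by a type K of that cardinality: [set: K] #<= A
   says that |A| is at least that cardinal, with aleph_0 given by K := nat. *)

(* Meant for Hausdorff X: separation is not part of the predicate. *)
Definition H_closed (X : topologicalType) : Prop :=
  forall V : set (set X),
    (forall U, V U -> open U) -> \bigcup_(U in V) U = [set: X] ->
    exists W : set (set X),
      [/\ W `<=` V, finite_set W & [set: X] = \bigcup_(U in W) closure U].

Definition theta_closure (X : topologicalType) (A : set X) : set X :=
  [set x | forall U : set X, open U -> U x -> closure U `&` A !=set0].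

Definition filter_base (T : Type) (F : set (set T)) : Prop :=
  [/\ F !=set0, (forall A, F A -> A !=set0) &
      forall A B, F A -> F B -> exists2 C, F C & C `<=` A `&` B].

Definition open_filter_base (X : topologicalType) (F : set (set X)) : Prop :=
  filter_base F /\ forall A, F A -> open A.

Definition adherence (X : topologicalType) (F : set (set X)) : set X :=
  \bigcap_(A in F) closure A.

Definition theta_adherence (X : topologicalType) (F : set (set X)) : set X :=
  \bigcap_(A in F) theta_closure A.

Definition wide (K : Type) (X : topologicalType) (F : set (set X)) : Prop :=
  forall A, F A -> [set: K] #<= theta_closure A.

Definition wH_closed (K : Type) (X : topologicalType) : Prop :=
  forall F : set (set X),
    filter_base F -> wide K F -> theta_adherence F !=set0.

(* Main.v *)
Require Import Defs.
From mathcomp Require Import all_boot all_order.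
From mathcomp Require Import boolp classical_sets functions cardinality topology.
Local Open Scope classical_set_scope.

(** For (a), H-closedness makes the theta-adherence of every filter base
    nonempty. Conversely, an open cover [V] none of whose finite subfamilies has
    dense union yields the open filter base of complements of finite unions of
    closures of members of [V]; it has empty theta-adherence, and its members
    are infinite because finitely many points are absorbed by finitely many
    members of [V].  For (b), the theta-closure of [A] is the intersection of
    the closures of the open supersets of [A], so a filter base and the filter
    base of its open supersets have the same theta-adherence. *)

Lemma sub_theta_closure (X : topologicalType) (A : set X) :
  A `<=` theta_closure A.
Proof. by move=> x Ax U _ Ux; exists x; split=> //; exact: subset_closure. Qed.

Lemma theta_closureS (X : topologicalType) (A B : set X) :
  A `<=` B -> theta_closure A `<=` theta_closure B.
Proof.
move=> AB x Ax U oU Ux; have [y [Uy Ay]] := Ax U oU Ux.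
by exists y; split=> //; exact: AB.
Qed.

(** A point of [closure U] that lies in an open [A] has [A] as a neighbourhood, so [U] itself
    already meets [A]. *)
Lemma theta_closure_open (X : topologicalType) (A : set X) :
  open A -> theta_closure A = closure A.
Proof.
move=> oA; apply/seteqP; split=> x Ax.
  move=> B; rewrite nbhsE => -[U [oU Ux] UB].
  have [y [Uy Ay]] := Ax U oU Ux.
  have [z [Uz Az]] := Uy A (open_nbhs_nbhs (conj oA Ay)).
  by exists z; split=> //; exact: UB.
move=> U oU Ux; have [y [Ay Uy]] := Ax U (open_nbhs_nbhs (conj oU Ux)).
by exists y; split=> //; exact: subset_closure.
Qed.

Lemma theta_closureE (X : topologicalType) (A : set X) :
  theta_closure A = \bigcap_(U in [set U | open U /\ A `<=` U]) closure U.
Proof.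
apply/seteqP; split=> x Ax.
  move=> U [oU AU]; rewrite -theta_closure_open//.
  exact: theta_closureS Ax.
move=> U oU Ux; apply: contrapT => UA.
(* If [closure U] misses [A], its complement is an open superset of [A], so [x] lies in the closure
   of that complement; but the neighbourhood [U] of [x] is disjoint from it. *)
have /(_ _ (open_nbhs_nbhs (conj oU Ux)))[y [nUy Uy]] : closure (~` closure U) x.
  apply: Ax; split; first exact/closed_openC/closed_closure.
  by move=> y Ay Uy; apply: UA; exists y.
exact/nUy/subset_closure.
Qed.

Lemma filter_base_bigcap (T : Type) (F W : set (set T)) :
  filter_base F -> finite_set W ->
  (forall U, W U -> exists2 A, F A & A `<=` U) ->
  exists2 A, F A & A `<=` \bigcap_(U in W) U.
Proof.
move=> [[A0 FA0] _ Fdir] /finite_seqP[s ->].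
elim: s => [_|U s IHs sF]; first by exists A0.
have [|A FA As] := IHs.
  by move=> B Bs; apply: sF; rewrite /= in_cons Bs orbT.
have [|B FB BU] := sF U; first by rewrite /= mem_head.
have [C FC CAB] := Fdir _ _ FA FB; exists C => // x /CAB[Ax Bx] D /=.
by rewrite in_cons => /orP[/eqP->|Ds]; [exact: BU|exact: As].
Qed.

Lemma H_closed_theta_adherence (X : topologicalType) (F : set (set X)) :
  H_closed X -> filter_base F -> theta_adherence F !=set0.
Proof.
move=> HX Ffb; apply: contrapT => F0.
(* An open [U] is in [V] when [closure U] misses some member of [F]; every point outside the
   theta-adherence has such a neighbourhood, so [V] covers [X]. *)
pose V := [set U : set X | open U /\ exists2 A, F A & A `<=` ~` closure U].
have [U []//||W [WV finW XW]] := HX V.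
  apply/seteqP; split=> // x _; apply: contrapT => Vx.
  apply: F0; exists x => A FA U oU Ux; apply: contrapT => UA.
  apply: Vx; exists U => //; split=> //; exists A => // y Ay Uy.
  by apply: UA; exists y.
(* One member of [F] avoids the closures of all [U] in [W]; these cover [X], yet that member is
   nonempty. *)
have [|A FA AW] :=
    @filter_base_bigcap _ F ((fun U => ~` closure U) @` W) Ffb
      (finite_image _ finW).
  by move=> _ [U WU <-]; have [] := WV _ WU.
have [_ /(_ A FA)[x Ax] _] := Ffb.
have [U WU Ux] : (\bigcup_(U in W) closure U) x by rewrite -XW.
by apply: (AW x Ax (~` closure U)) Ux; exists U.
Qed.

Lemma wH_closed_nat_H_closed (X : topologicalType) :
  wH_closed nat X -> H_closed X.
Proof.
move=> wX V oV XV; apply: contrapT => nW.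
pose C (W : set (set X)) := ~` \bigcup_(U in W) closure U.
pose F := [set C W | W in [set W | W `<=` V /\ finite_set W]].
have C0 W : W `<=` V -> finite_set W -> C W !=set0.
  move=> WV finW; apply: contrapT => CW; apply: nW; exists W; split=> //.
  apply/seteqP; split=> // x _; apply: contrapT => Wx.
  by apply: CW; exists x.
have /choice[f fV] : forall x : X, exists U, V U /\ U x.
  move=> x; have [U VU Ux] : (\bigcup_(U in V) U) x by rewrite XV.
  by exists U.
have [||x Fx] := wX F.
- split.
    by exists (C set0); exists set0 => //; split; [exact: sub0set|exact: finite_set0].
    by move=> _ [W [WV finW] <-]; exact: C0.
  move=> _ _ [W1 [W1V fin1] <-] [W2 [W2V fin2] <-].
  exists (C (W1 `|` W2)).
    exists (W1 `|` W2) => //; split; last by rewrite finite_setU.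
    by rewrite subUset.
  by rewrite /C bigcup_setU setCU.
(* If [theta_closure (C W)] is finite, so is [C W]; enlarging [W] by the finitely many [f x] with
   [x] in [C W] leaves nothing uncovered, against [C0]. *)
- move=> _ [W [WV finW] <-]; apply/infiniteP => finC.
  have finCW := sub_finite_set (@sub_theta_closure _ _) finC.
  have [||x /= nWx] := C0 (W `|` f @` C W).
  + by rewrite subUset; split=> // _ [x _ <-]; have [] := fV x.
  + by rewrite finite_setU; split=> //; exact: finite_image.
  + have CWx : C W x by move=> [U WU Ux]; apply: nWx; exists U => //; left.
    apply: nWx; exists (f x); first by right; exists x.
    by apply: subset_closure; have [] := fV x.
(* The neighbourhood [f x] of [x] and the member [C [set f x]] of [F], the complement of
   [closure (f x)], refute [Fx]. *)
have [Vfx fx] := fV x.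
have [|y [fy Cy]] := Fx (C [set f x]) _ _ (oV _ Vfx) fx.
  by exists [set f x] => //; split=> // _ ->.
by apply: Cy; exists (f x).
Qed.

Lemma open_adherence (X : topologicalType) (F : set (set X)) :
  (forall A, F A -> open A) -> theta_adherence F = adherence F.
Proof. by move=> oF; apply: eq_bigcapr => A /oF /theta_closure_open. Qed.

(** These are the open members of the filter generated by [F]. *)
Definition open_supersets {X : topologicalType} (F : set (set X)) :=
  [set U : set X | open U /\ exists2 A, F A & A `<=` U].

Lemma open_supersets_filter_base (X : topologicalType) (F : set (set X)) :
  filter_base F -> open_filter_base (open_supersets F).
Proof.
move=> [[A0 FA0] F0 Fdir]; split; last by move=> U [].
split.
- by exists setT; split; [exact: openT|exists A0].
- by move=> U [_ [A FA AU]]; have [x /AU] := F0 A FA; exists x.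
- move=> U1 U2 [oU1 [A1 FA1 AU1]] [oU2 [A2 FA2 AU2]].
  exists (U1 `&` U2) => //; split; first exact: openI.
  have [A FA AA] := Fdir _ _ FA1 FA2; exists A => //.
  exact: subset_trans AA (setISS AU1 AU2).
Qed.

Lemma wide_open_supersets (K : Type) (X : topologicalType) (F : set (set X)) :
  wide K F -> wide K (open_supersets F).
Proof.
move=> wF U [_ [A FA AU]]; apply: card_le_trans (wF A FA) _.
exact/subset_card_le/theta_closureS.
Qed.

Lemma adherence_open_supersets (X : topologicalType) (F : set (set X)) :
  adherence (open_supersets F) = theta_adherence F.
Proof.
apply/seteqP; split=> x Fx.
  by move=> A FA; rewrite theta_closureE => U [oU AU]; apply: Fx; split=> //; exists A.
by move=> U [oU [A FA AU]]; have := Fx A FA; rewrite theta_closureE; apply.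
Qed.

Theorem proposition5p6 (X : topologicalType) (K : Type)
    (hX : hausdorff_space X) (hK : infinite_set [set: K]) :
  (H_closed X <-> wH_closed nat X) /\
  (wH_closed K X <->
   forall F : set (set X),
     open_filter_base F -> wide K F -> adherence F !=set0).
Proof.
split; split.
- by move=> HX F Ffb _; exact: H_closed_theta_adherence.
- exact: wH_closed_nat_H_closed.
- by move=> wX F [Ffb oF] wF; rewrite -open_adherence//; exact: wX.
- move=> aX F Ffb wF; rewrite -adherence_open_supersets; apply: aX.
    exact: open_supersets_filter_base.
  exact: wide_open_supersets.
Qed.
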